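(* Assume the standing model assumptions below. There exists a constant $C_0>0$, depending only on $d$, $C_V$, $\|\Psi\|$, $\|F\|$, $C_F$, $\sup_k m_k^{-1}$ and $\sup_k \nu_k$ (in particular independent of $f,g,X,Y,\Lambda,t$), with the following property. Let $X,Y\subset\Gamma$ be finite with $\mathrm{dist}(X,Y):=\min_{x\in X,y\in Y}\rho(x,y)>0$, let $\Lambda\subset\Gamma$ be finite with $X\cup Y\subset\Lambda$, and let $f_0\in C_b^1(\Omega_X)$, $g_0\in C^1_b(\Omega_Y)$, $f:=f_0\circ\pi_{X,\Lambda}$, $g:=g_0\circ\pi_{Y,\Lambda}$. Then for all $t\in\mathbb R$, $$\|\{\alpha^t_\Lambda(f),g\}\|_\infty\le 4\,\|f\|_{C^1}\|g\|_{C^1}\,\sqrt{C_0}\,\sinh(\sqrt{C_0}|t|)\,D(X,Y),$$ and in particular $$\|\{\alpha^t_\Lambda(f),g\}\|_\infty\le 4\,\|f\|_{C^1}\|g\|_{C^1}\,\sqrt{C_0}\,\big(e^{\sqrt{C_0}|t|}-1\big)\,D(X,Y),$$ where $D(X,Y):=\sum_{x\in X}\sum_{y\in Y}F(\rho(x,y))$.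
   Context: Standing model assumptions. Fix an integer $d\ge1$. $\Gamma$ is a countable set with a metric $\rho$. $F:[0,\infty)\to(0,\infty)$ is non-increasing with $F(0)=1$, $\|F\|:=\sup_{y\in\Gamma}\sum_{x\in\Gamma}F(\rho(x,y))<\infty$, and there is $C_F>0$ with $\sum_{z\in\Gamma}F(\rho(x,z))F(\rho(z,y))\le C_F F(\rho(x,y))$ for all $x,y\in\Gamma$. For each $k\in\Gamma$ there are a mass $m_k>0$ and a force constant $\nu_k>0$ with $0<\inf_k m_k^{-1}\le\sup_k m_k^{-1}<\infty$ and $0<\inf_k\nu_k\le\sup_k\nu_k<\infty$. For $k,l\in\Gamma$, $V_{kl}:\mathbb R^d\to\mathbb R$ is smooth, $V_{kl}(x)=V_{lk}(-x)$, $V_{kk}=0$, and there are constants $C_V\ge0$, $C_{kl}>0$ with $\|\partial^\beta V_{kl}\|_\infty\le C_{kl}C_V^{|\beta|}$ for every multi-index $\beta$; moreover $\|\Psi\|:=\sup_{k,l\in\Gamma}C_{kl}/F(\rho(k,l))<\infty$. For finite $\Lambda\subset\Gamma$, $\Omega_\Lambda$ is the space of pairs $(p,q)=((p_k)_{k\in\Lambda},(q_k)_{k\in\Lambda})$ with $p_k,q_k\in\mathbb R^d$, i.e. $\Omega_\Lambda\cong\mathbb R^{2|\Lambda|d}$ with Euclidean norm $\|\cdot\|_2$. The local Hamiltonian is $H_\Lambda(p,q)=\sum_{k\in\Lambda}\big(\frac{\|p_k\|^2}{2m_k}+\frac{\nu_k\|q_k\|^2}{2}\big)+\frac12\sum_{k,l\in\Lambda}V_{kl}(q_k-q_l)$;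 its Hamiltonian flow $\Phi^\Lambda_t:\Omega_\Lambda\to\Omega_\Lambda$ is globally defined, and $\alpha^t_\Lambda(h):=h\circ\Phi^\Lambda_t$. For $X\subset\Lambda$, $\Omega_X\subset\Omega_\Lambda$ (entries outside $X$ zero) and $\pi_{X,\Lambda}:\Omega_\Lambda\to\Omega_X$ is the orthogonal projection. $C_b^1(\Omega_X)$ denotes bounded $C^1$ functions with bounded gradient; $\|h\|_{C^1}:=\|h\|_\infty+\sup_{(p,q)}\|\nabla h(p,q)\|_2$. The Poisson bracket on $\Omega_\Lambda$ is $\{h_1,h_2\}=\sum_{j\in\Lambda}\sum_{i=1}^d\big(\frac{\partial h_1}{\partial q_{j,i}}\frac{\partial h_2}{\partial p_{j,i}}-\frac{\partial h_1}{\partial p_{j,i}}\frac{\partial h_2}{\partial q_{j,i}}\big)$. *)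

(* Defs.v *)
From HB Require Import structures.
From mathcomp Require Import all_boot all_order all_algebra finmap.
From mathcomp Require Import all_classical all_reals all_analysis.
Set Implicit Arguments. Unset Strict Implicit. Unset Printing Implicit Defensive.
Import Order.TTheory GRing.Theory Num.Theory.
Import numFieldNormedType.Exports.
Local Open Scope classical_set_scope.
Local Open Scope ring_scope.

Section Model.
Variables (R : realType) (d : nat) (Γ : choiceType).

(** A point (p,q) of phaseSp space: p_k, q_k in R^d (row vectors) for each k.
    OmegaL Λ = the points whose entries outside Λ vanish (Ω_Λ ⊂ Ω_Γ). *)
Definition phaseSp := ((Γ -> 'rV[R]_d) * (Γ -> 'rV[R]_d))%type.

Definition OmegaL (L : {fset Γ}) : set phaseSp :=
  [set z | forall k, k \notin L -> z.1 k = 0 /\ z.2 k = 0].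

Definition projX (X : {fset Γ}) (z : phaseSp) : phaseSp :=
  (fun k => if k \in X then z.1 k else 0, fun k => if k \in X then z.2 k else 0).

Definition evec (i : 'I_d) : 'rV[R]_d := delta_mx 0 i.

Definition bumpP (z : phaseSp) (j : Γ) (i : 'I_d) (s : R) : phaseSp :=
  (fun k => if k == j then z.1 k + s *: evec i else z.1 k, z.2).
Definition bumpQ (z : phaseSp) (j : Γ) (i : 'I_d) (s : R) : phaseSp :=
  (z.1, fun k => if k == j then z.2 k + s *: evec i else z.2 k).

Definition dP (h : phaseSp -> R) (z : phaseSp) (j : Γ) (i : 'I_d) : R :=
  derive1 (fun s => h (bumpP z j i s)) 0.
Definition dQ (h : phaseSp -> R) (z : phaseSp) (j : Γ) (i : 'I_d) : R :=
  derive1 (fun s => h (bumpQ z j i s)) 0.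

Definition pbracket (L : {fset Γ}) (h1 h2 : phaseSp -> R) (z : phaseSp) : R :=
  \sum_(j <- L) \sum_(i < d)
     (dQ h1 z j i * dP h2 z j i - dP h1 z j i * dQ h2 z j i).

Definition gradnorm (L : {fset Γ}) (h : phaseSp -> R) (z : phaseSp) : R :=
  Num.sqrt (\sum_(j <- L) \sum_(i < d) (dP h z j i ^+ 2 + dQ h z j i ^+ 2)).

Definition dist2 (L : {fset Γ}) (z w : phaseSp) : R :=
  Num.sqrt (\sum_(j <- L) \sum_(i < d)
     ((z.1 j 0 i - w.1 j 0 i) ^+ 2 + (z.2 j 0 i - w.2 j 0 i) ^+ 2)).

(** h ∈ C_b^1(Ω_L): bounded, all partial derivatives (in the Ω_L
    coordinates) exist, are continuous on Ω_L, and the gradient is bounded.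
    (Continuous partials on the finite-dimensional Ω_L = C^1.) *)
Definition C1b (L : {fset Γ}) (h : phaseSp -> R) : Prop :=
  [/\ exists M : R, forall z, OmegaL L z -> `|h z| <= M,
      forall z j i, OmegaL L z -> j \in L ->
        derivable (fun s => h (bumpP z j i s)) 0 1 /\
        derivable (fun s => h (bumpQ z j i s)) 0 1,
      forall z j i, OmegaL L z -> j \in L -> forall e : R, 0 < e ->
        exists2 del : R, 0 < del & forall w, OmegaL L w -> dist2 L z w < del ->
          `|dP h w j i - dP h z j i| < e /\ `|dQ h w j i - dQ h z j i| < e
    & exists M : R, forall z, OmegaL L z -> gradnorm L h z <= M].

Definition supnorm (L : {fset Γ}) (h : phaseSp -> R) : R :=
  sup [set `|h z| | z in OmegaL L].
Definition C1norm (L : {fset Γ}) (h : phaseSp -> R) : R :=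
  supnorm L h + sup [set gradnorm L h z | z in OmegaL L].

Definition sqn (x : 'rV[R]_d) : R := \sum_(i < d) x 0 i ^+ 2.

Definition Ham (m nu : Γ -> R) (V : Γ -> Γ -> 'rV[R]_d -> R)
  (L : {fset Γ}) (z : phaseSp) : R :=
  \sum_(k <- L) (sqn (z.1 k) / (2 * m k) + nu k * sqn (z.2 k) / 2)
  + 2^-1 * \sum_(k <- L) \sum_(l <- L) V k l (z.2 k - z.2 l).

Definition is_ham_flow (H : phaseSp -> R) (L : {fset Γ})
  (Phi : R -> phaseSp -> phaseSp) : Prop :=
  forall z, OmegaL L z ->
    Phi 0 z = z /\
    forall t : R, OmegaL L (Phi t z) /\
      forall k i, k \in L ->
        is_derive t 1 (fun s => (Phi s z).1 k 0 i) (- dQ H (Phi t z) k i) /\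
        is_derive t 1 (fun s => (Phi s z).2 k 0 i) (dP H (Phi t z) k i).

Definition Dxy (F : R -> R) (rho : Γ -> Γ -> R) (X Y : {fset Γ}) : R :=
  \sum_(x <- X) \sum_(y <- Y) F (rho x y).

End Model.

(** iterated partial derivatives ∂^β on R^d; β given as the list of the
    coordinate directions (|β| = its length) *)
Definition iterPD (R : realType) (d : nat) (s : seq 'I_d)
  (G : 'rV[R]_d -> R) : 'rV[R]_d -> R :=
  foldr (fun i (H : 'rV[R]_d -> R) => fun x => derive H x (evec R i)) G s.

Definition smoothRd (R : realType) (d : nat) (G : 'rV[R]_d -> R) : Prop :=
  forall (s : seq 'I_d) x, differentiable (iterPD s G) x.

Definition sinhR (R : realType) (x : R) : R := (expR x - expR (- x)) / 2.

(* Main.v *)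
Require Import Defs.
From HB Require Import structures.
From mathcomp Require Import all_boot all_order all_algebra finmap.
From mathcomp Require Import all_classical all_reals all_analysis.
From mathcomp Require Import ring lra.
Import Order.TTheory GRing.Theory Num.Theory.
Import numFieldNormedType.Exports.
Local Open Scope classical_set_scope.
Local Open Scope ring_scope.

Set Implicit Arguments.
Unset Strict Implicit.
Unset Printing Implicit Defensive.

(** Perturb the initial datum in one coordinate at a site [j] of [Y] by [s].  The
    difference of the two trajectories satisfies a linear differential
    inequality whose coupling is controlled by the kernel [F (rho k l)]; since
    [F] reproduces itself under convolution up to [CF], the profile
    [s * F (rho k j) * expR (K * t)] is a supersolution, so away from [j] the
    difference is at most [s * F (rho k j) * (expR (K * t) - 1)].  The bracket
    sees the flow only through difference quotients in the initial datum, so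
    this Lipschitz bound suffices: the flow is never differentiated in its
    initial datum. *)

(** * Derivatives and increments of scalar functions *)

(* If the difference quotient has no limit, [derive1] is the junk value 0, so no
   differentiability is assumed. *)
Lemma norm_derive1_le (R : realType) (h : R -> R) (B : R) :
  (forall s, `|h s - h 0| <= B * `|s|) -> `|derive1 h 0| <= B.
Proof.
move=> hB.
have B0 : 0 <= B by apply: le_trans (normr_ge0 _) (le_trans (hB 1) _); rewrite normr1 mulr1.
rewrite /derive1.
set q := (X in X @ _).
have [cq|ncq] := pselect (cvg (q @ 0^')); last by rewrite (dvgP ncq) normr0.
suff : closed_ball_ (@Num.norm R R) 0 B (lim (q @ 0^')) by rewrite /closed_ball_ /= sub0r normrN.
apply: (closed_cvg _ (@closed_closed_ball_ _ _ 0 B) _ _ cq).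
near=> s.
have s0 : s != 0 by near: s; exact: nbhs_dnbhs_neq.
rewrite /closed_ball_ /= sub0r normrN /q addr0 normrZ normfV.
by rewrite mulrC ler_pdivrMr ?normr_gt0.
Unshelve. all: by end_near. Qed.

Lemma is_derive1_ext (R : numFieldType) (V : normedModType R) (f g : R -> V) (x : R) (l : V) :
  f =1 g -> is_derive x 1 f l -> is_derive x 1 g l.
Proof. by move=> /funext ->. Qed.

(** On [[0, T]] both [b + g] and [b - g] have nonnegative derivative, so by the mean value theorem
    neither is smaller at [T] than at 0. *)
Lemma is_derive_increment (R : realType) (g b g' b' : R -> R) (T : R) :
  0 <= T ->
  (forall t : R, is_derive t (1:R) g (g' t)) ->
  (forall t : R, is_derive t (1:R) b (b' t)) ->
  (forall t, 0 <= t <= T -> `|g' t| <= b' t) ->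
  `|g T - g 0| <= b T - b 0.
Proof.
move=> T0 dg db le_gb.
have pos (h h' : R -> R) : (forall t : R, is_derive t (1:R) h (h' t)) ->
    (forall t, 0 <= t <= T -> 0 <= h' t) -> h 0 <= h T.
  move=> dh h'0.
  have ch : {within `[0, T], continuous h}.
    by apply: derivable_within_continuous => x _; have [] := dh x.
  have [c cT e] := MVT_segment T0 (fun x _ => dh x) ch.
  rewrite -subr_ge0 e subr0; apply: mulr_ge0 => //; apply: h'0.
  by move: cT; rewrite in_itv.
rewrite ler_norml lerBlDr; apply/andP; split.
  have := pos (b + g) (fun t => b' t + g' t).
  move=> /(_ (fun t => is_deriveD _ _)) H.
  have {H} : (b + g) 0 <= (b + g) T.
    by apply: H => t /le_gb; rewrite ler_norml => /andP[h _]; lra.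
  by rewrite !fctE; lra.
have := pos (b - g) (fun t => b' t - g' t).
move=> /(_ (fun t => is_deriveB _ _)) H.
have {H} : (b - g) 0 <= (b - g) T.
  by apply: H => t /le_gb; rewrite ler_norml => /andP[_ h]; lra.
by rewrite !fctE; lra.
Qed.

Lemma is_derive_expRM (R : realType) (a K t : R) :
  is_derive t (1:R) (fun s => a * expR (K * s)) (a * (K * expR (K * t))).
Proof.
have h1 : is_derive t (1:R) (fun s : R => K * s) K.
  by have := is_deriveZ K (is_derive_id t (1:R)); rewrite /GRing.scale /= mulr1.
have h2 := @is_derive1_comp R expR (fun s => K * s) t _ _ (is_derive_expR _) h1.
have := is_deriveZ a h2.
by rewrite (mulrC _ K).
Qed.

(** * Weighted growth of linear differential inequalities *)

(** The factor [K / 2], in place of [K], makes the argument contract: a bound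
    [M * w c * expR (K * t)] on [u c] integrates to an increment of at most
    [M / 2 * w c * (expR (K * t) - 1)], which halves [M]. *)
Lemma growth_forward (R : realType) (I : finType) (u u' : I -> R -> R)
    (w : I -> R) (K : R) :
  0 < K -> (forall c, 0 < w c) ->
  (forall c (t : R), is_derive t (1:R) (u c) (u' c t)) ->
  (forall c, `|u c 0| <= w c) ->
  (forall t M : R, 0 <= M -> (forall c, `|u c t| <= M * w c) ->
     forall c, `|u' c t| <= M * (K / 2) * w c) ->
  forall (T : R) c, 0 <= T -> `|u c T - u c 0| <= w c * (expR (K * T) - 1).
Proof.
move=> K0 w0 du u0 dom T c T0.
pose P (M : R) := forall (t : R) c, 0 <= t <= T -> `|u c t| <= M * w c * expR (K * t).
have step (M : R) : 0 <= M -> P M -> forall (t : R) c, 0 <= t <= T ->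
    `|u c t - u c 0| <= M / 2 * w c * (expR (K * t) - 1).
  move=> M0 PM t e /andP[t0 tT].
  have := @is_derive_increment R (u e) (fun s => M / 2 * w e * expR (K * s))
    (u' e) (fun s => M / 2 * w e * (K * expR (K * s))) t t0 (du e) (is_derive_expRM _ K).
  rewrite mulr0 expR0 mulrBr => -> // r /andP[r0 rt].
  have := dom r (M * expR (K * r)) (mulr_ge0 M0 (expR_ge0 _)).
  have -> : M / 2 * w e * (K * expR (K * r)) = M * expR (K * r) * (K / 2) * w e by field.
  apply=> a; rewrite mulrAC; apply: PM.
  by rewrite r0 (le_trans rt).
have E1 t : 0 <= t -> 1 <= expR (K * t).
  by move=> t0; rewrite -expR0 ler_expR mulr_ge0// ltW.
(* A crude a priori bound [M] improves to [max 1 (M / 2)]; iterating this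
   replaces Gronwall's lemma. *)
have up M : 0 <= M -> P M -> P (Num.max 1 (M / 2)).
  move=> M0 PM t e tT.
  have t0 : 0 <= t by case/andP: tT.
  apply: le_trans (_ : `|u e 0| + `|u e t - u e 0| <= _).
    by rewrite -[X in `|X| <= _](subrKC (u e 0)) ler_normD.
  apply: le_trans (lerD (u0 e) (step M M0 PM t e tT)) _.
  set m := Num.max 1 (M / 2).
  have m1 : 1 <= m by rewrite le_max lexx.
  have m2 : M / 2 <= m by rewrite le_max lexx orbT.
  have h1 : w e <= m * w e by rewrite ler_peMl // ltW.
  have h2 : M / 2 * w e * (expR (K * t) - 1) <= m * w e * (expR (K * t) - 1).
    by rewrite ler_wpM2r ?subr_ge0 ?E1// ler_wpM2r// ltW.
  by apply: le_trans (lerD h1 h2) _; rewrite mulrBr mulr1 subrKC.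
(* The iteration needs a finite start: each [u c] is bounded on the compact [[0, T]], and a sum over
   the finitely many components makes the bound uniform. *)
have [M M0 PM] : exists2 M, 0 <= M & P M.
  have cu e : {within `[0, T], continuous (fun t => `|u e t|)}.
    apply: continuous_subspaceT => x; apply: (@continuous_comp _ _ _ (u e) (@Num.norm R R)).
      by apply/differentiable_continuous/derivable1_diffP; have [] := du e x.
    exact: norm_continuous.
  have ub e : exists m, forall t, 0 <= t <= T -> `|u e t| <= m * w e.
    have [x _ hx] := EVT_max T0 (cu e).
    exists (`|u e x| / w e) => t tT; rewrite divfK ?gt_eqF//.
    by apply: hx; rewrite in_itv.
  have [m hm] := choice ub.
  exists (\sum_e `|m e|); first exact: sumr_ge0.
  move=> t e tT; apply: le_trans (hm e t tT) _.
  have t0 : 0 <= t by case/andP: tT.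
  have h : m e * w e <= (\sum_e `|m e|) * w e.
    rewrite ler_wpM2r ?(ltW (w0 e))// (bigD1 e)//=.
    by apply: (le_trans (ler_norm _)); rewrite lerDl sumr_ge0.
  apply: le_trans h _; rewrite ler_peMr ?E1// mulr_ge0 ?sumr_ge0//.
  exact: ltW.
have PMn n : P (Num.max 1 (M / 2 ^+ n)).
  elim: n => [|n IHn].
    rewrite expr0 divr1 => t e tT; apply: (le_trans (PM t e tT)).
    rewrite ler_wpM2r ?expR_ge0// ler_wpM2r ?(ltW (w0 e))//.
    by rewrite le_max lexx orbT.
  have := up _ _ IHn; rewrite le_max ler01 => /(_ isT).
  rewrite exprSr invfM mulrA.
  rewrite maxr_pMl ?invr_ge0//.
  rewrite maxA (max_l (y := 1 * 2^-1)) // mul1r; lra.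
(* Finitely many halvings suffice: once [2 ^+ n] exceeds [M], the maximum is exactly 1. *)
have P1 : P 1.
  have [n hn] : exists n, M <= 2 ^+ n :> R.
    exists (Num.bound M); apply: le_trans (ltW (archi_boundP M0)) _.
    by rewrite -natrX ler_nat ltnW// ltn_expl.
  have := PMn n; rewrite max_l // ler_pdivrMr ?mul1r// exprn_gt0//; lra.
apply: le_trans (step 1 ler01 P1 T c _) _; first by rewrite T0 lexx.
rewrite ler_wpM2r ?subr_ge0 ?E1// ler_piMl ?(ltW (w0 c))//; lra.
Qed.

(** The hypotheses survive time reversal, since they hold at every real time and only bound absolute
    values; negative times reduce to [u c (- s)]. *)
Lemma growth_bound (R : realType) (I : finType) (u u' : I -> R -> R)
    (w : I -> R) (K : R) :
  0 < K -> (forall c, 0 < w c) ->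
  (forall c (t : R), is_derive t (1:R) (u c) (u' c t)) ->
  (forall c, `|u c 0| <= w c) ->
  (forall t M : R, 0 <= M -> (forall c, `|u c t| <= M * w c) ->
     forall c, `|u' c t| <= M * (K / 2) * w c) ->
  forall (t : R) c, `|u c t - u c 0| <= w c * (expR (K * `|t|) - 1).
Proof.
move=> K0 w0 du u0 dom t c.
have [t0|/ltW t0] := leP 0 t.
  by rewrite (ger0_norm t0); apply: (@growth_forward R I u u' w K).
rewrite (ler0_norm t0).
have := @growth_forward R I (fun c s => u c (- s)) (fun c s => - u' c (- s)) w K K0 w0 _ _ _ (- t) c.
rewrite opprK oppr0; apply => //; last by rewrite oppr_ge0.
- move=> e s.
  have hN : is_derive s (1:R) (fun x : R => - x) (- 1).
    exact: is_deriveN.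
  have := @is_derive1_comp R (u e) (fun x => - x) s _ _ (du e _) hN.
  by rewrite mulrN1.
- by move=> s M M0 h e; rewrite normrN; apply: dom.
Qed.

(** * Lipschitz bounds on the line *)

Lemma lipschitz_of_derive (R : realType) (g g' : R -> R) (N : R) :
  (forall t : R, is_derive t (1:R) g (g' t)) -> (forall t, `|g' t| <= N) ->
  forall x y, `|g x - g y| <= N * `|x - y|.
Proof.
move=> dg gN x y; wlog xy : x y / y <= x => [hw|].
  by case: (leP y x) => [/hw//|/ltW/hw]; rewrite (distrC (g x)) (distrC x).
have cg : {within `[y, x], continuous g}.
  by apply: derivable_within_continuous => t _; have [] := dg t.
have [c _ ->] := MVT_segment xy (fun t _ => dg t) cg.
by rewrite normrM ler_wpM2r.
Qed.

(** Partial derivatives are taken at increment 0 from a base point; this turns them into derivatives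
    along a whole coordinate line. *)
Lemma is_derive_translate (R : realType) (g : R -> R) (t l : R) :
  is_derive (0:R) (1:R) (fun s => g (t + s)) l -> is_derive t (1:R) g l.
Proof.
move=> dg.
have hs : is_derive t (1:R) (fun s : R => s - t) 1.
  by have := is_deriveB (is_derive_id t (1:R)) (is_derive_cst t t (1:R)); rewrite subr0.
rewrite -(subrr t) in dg.
have := @is_derive1_comp R (fun s => g (t + s)) (fun s => s - t) t _ _ dg hs.
by rewrite mulr1; apply: is_derive1_ext => s /=; rewrite addrC subrK.
Qed.

(** * Scalar coordinates, bumps and projections in phase space *)

(* The 2d scalar coordinates of a site are indexed by [bool * 'I_d]: [true]
   selects the momentum, [false] the position. *)
Definition entry (R : realType) (d : nat) (Γ : choiceType) (z : phaseSp R d Γ)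
    (k : Γ) (p : bool * 'I_d) : R :=
  (if p.1 then z.1 else z.2) k 0 p.2.

Definition bump (R : realType) (d : nat) (Γ : choiceType) (z : phaseSp R d Γ)
    (k : Γ) (p : bool * 'I_d) (s : R) : phaseSp R d Γ :=
  if p.1 then bumpP z k p.2 s else bumpQ z k p.2 s.

(** Convertible to [dP] or [dQ] once the boolean is known, so that both kinds of derivative are
    treated together. *)
Definition partial (R : realType) (d : nat) (Γ : choiceType)
    (h : phaseSp R d Γ -> R) (z : phaseSp R d Γ) (k : Γ) (p : bool * 'I_d) : R :=
  derive1 (fun s => h (bump z k p s)) 0.

Lemma phaseSp_ext (R : realType) (d : nat) (Γ : choiceType) (z w : phaseSp R d Γ) :
  (forall k p, entry z k p = entry w k p) -> z = w.
Proof.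
case: z w => [p q] [p' q'] e; congr pair; apply/funext => k; apply/rowP => i.
  exact: (e k (true, i)).
exact: (e k (false, i)).
Qed.

(** Through [phaseSp_ext], the identities [bump0], [bumpD] and [projX_bump] reduce to this indicator
    formula. *)
Lemma entry_bump (R : realType) (d : nat) (Γ : choiceType) (z : phaseSp R d Γ)
    k p s k' p' :
  entry (bump z k p s) k' p' = entry z k' p' + s * ((k' == k) && (p' == p))%:R.
Proof.
case: p p' => [b i] [b' i']; rewrite /entry /bump xpair_eqE /=.
case: b => /=; case: b' => /=; case: eqP => [->|_] //=;
  rewrite ?mulr0 ?addr0// !mxE eqxx eq_sym /=; by rewrite eq_sym.
Qed.

Lemma entry_projX (R : realType) (d : nat) (Γ : choiceType) (X : {fset Γ})
    (z : phaseSp R d Γ) k p :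
  entry (projX X z) k p = if k \in X then entry z k p else 0.
Proof. by rewrite /entry; case: p => [[] i] /=; case: ifP => //; rewrite mxE. Qed.

Lemma OmegaLP (R : realType) (d : nat) (Γ : choiceType) (X : {fset Γ})
    (z : phaseSp R d Γ) :
  OmegaL X z <-> (forall k p, k \notin X -> entry z k p = 0).
Proof.
split=> [Xz k p /Xz[p0 q0]|Xz k /Xz z0].
  by rewrite /entry; case: p.1; rewrite ?p0 ?q0 mxE.
by split; apply/rowP => i; rewrite mxE; [exact: (z0 (true, i))|exact: (z0 (false, i))].
Qed.

Lemma bump0 (R : realType) (d : nat) (Γ : choiceType) (z : phaseSp R d Γ) k p :
  bump z k p 0 = z.
Proof. by apply: phaseSp_ext => k' p'; rewrite entry_bump mul0r addr0. Qed.

Lemma bumpD (R : realType) (d : nat) (Γ : choiceType) (z : phaseSp R d Γ) k p s t :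
  bump (bump z k p s) k p t = bump z k p (s + t).
Proof. by apply: phaseSp_ext => k' p'; rewrite !entry_bump mulrDl addrA. Qed.

Lemma OmegaL_bump (R : realType) (d : nat) (Γ : choiceType) (X : {fset Γ})
    (z : phaseSp R d Γ) k p s :
  k \in X -> OmegaL X z -> OmegaL X (bump z k p s).
Proof.
move=> kX /OmegaLP Xz; apply/OmegaLP => k' p' k'X; rewrite entry_bump Xz//.
by case: eqP k'X => [->|_ _]; rewrite ?kX// mulr0 addr0.
Qed.

Lemma OmegaL_projX (R : realType) (d : nat) (Γ : choiceType) (X : {fset Γ})
    (z : phaseSp R d Γ) : OmegaL X (projX X z).
Proof. by apply/OmegaLP => k p kX; rewrite entry_projX (negbTE kX). Qed.

Lemma OmegaL_sub (R : realType) (d : nat) (Γ : choiceType) (X L : {fset Γ})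
    (z : phaseSp R d Γ) : fsubset X L -> OmegaL X z -> OmegaL L z.
Proof.
by move=> /fsubsetP XL /OmegaLP Xz; apply/OmegaLP => k p kL; apply: Xz; apply: contra kL; exact: XL.
Qed.

Lemma projX_id (R : realType) (d : nat) (Γ : choiceType) (X : {fset Γ})
    (z : phaseSp R d Γ) : OmegaL X z -> projX X z = z.
Proof.
move=> /OmegaLP Xz; apply: phaseSp_ext => k p; rewrite entry_projX.
by case: ifPn => // /Xz ->.
Qed.

Lemma projX_bump (R : realType) (d : nat) (Γ : choiceType) (X : {fset Γ})
    (z : phaseSp R d Γ) k p s :
  projX X (bump z k p s) = if k \in X then bump (projX X z) k p s else projX X z.
Proof.
apply: phaseSp_ext => k' p'; rewrite entry_projX entry_bump; case: ifPn => k'X.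
  case: ifPn => kX; rewrite ?entry_bump !entry_projX k'X//.
  by case: eqP k'X kX => [-> ->|_ _ _] //=; rewrite mulr0 addr0.
case: ifPn => kX; rewrite ?entry_bump !entry_projX (negbTE k'X)//.
by case: eqP k'X => [->|_ _] /=; rewrite ?kX// mulr0 addr0.
Qed.

Lemma partial_projX (R : realType) (d : nat) (Γ : choiceType) (X : {fset Γ})
    (h : phaseSp R d Γ -> R) (z : phaseSp R d Γ) k p :
  partial (h \o projX X) z k p = if k \in X then partial h (projX X z) k p else 0.
Proof.
rewrite /partial; under [X in derive1 X]eq_fun do rewrite /= projX_bump.
by case: ifPn => // _; exact: derive1_cst.
Qed.

(** * Lipschitz bounds for local observables *)

(** One coordinate is changed at a time, inside [OmegaL X], with the one-variable mean value theorem
    on each segment; only partial derivatives enter. *)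
Lemma entrywise_lipschitz (R : realType) (d : nat) (Γ : choiceType)
    (X : {fset Γ}) (h : phaseSp R d Γ -> R) (N : R) :
  (forall z k p, OmegaL X z -> k \in X ->
     derivable (fun s => h (bump z k p s)) 0 1 /\ `|partial h z k p| <= N) ->
  forall z w, OmegaL X z -> OmegaL X w ->
  `|h z - h w| <= N * \sum_(k <- X) \sum_p `|entry z k p - entry w k p|.
Proof.
move=> dh z w Xz Xw.
(* Induction on a list [cs] containing every coordinate where the points may differ; [z] is
   generalized because each step moves it. *)
suff key (cs : seq (Γ * (bool * 'I_d))) : all (fun c => c.1 \in X) cs ->
    forall z, OmegaL X z ->
    (forall k p, (k, p) \notin cs -> entry z k p = entry w k p) ->
    `|h z - h w| <= N * \sum_(c <- cs) `|entry z c.1 c.2 - entry w c.1 c.2|.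
  have := key [seq (k, p) | k <- X, p <- enum {: bool * 'I_d}] _ z Xz.
  rewrite big_allpairs; under eq_bigr do rewrite big_enum.
  apply; first by apply/allP => _ /allpairsP[[k p] [? _ ->]].
  move=> k p kp; have kX : k \notin X.
    by apply: contra kp => kX; apply/allpairsP; exists (k, p); split; rewrite // mem_enum.
  by move/OmegaLP: Xz => ->//; move/OmegaLP: Xw => ->.
elim: cs => [_|[k p] cs IH /andP[/= kX csX]] {Xz}z Xz zw.
  by rewrite (phaseSp_ext (fun k p => zw k p isT)) subrr normr0 big_nil mulr0.
have N0 : 0 <= N by apply: le_trans (normr_ge0 _) (dh z k p Xz kX).2.
set s := entry w k p - entry z k p.
pose z' := bump z k p s.
have Xz' : OmegaL X z' by exact: OmegaL_bump.
have h1 : `|h z - h z'| <= N * `|entry z k p - entry w k p|.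
  have dg (t : R) : is_derive t (1:R) (fun r => h (bump z k p r)) (partial h (bump z k p t) k p).
    apply: is_derive_translate.
    have [dz _] := dh (bump z k p t) k p (OmegaL_bump p t kX Xz) kX.
    rewrite /partial derive1E; apply: is_derive1_ext (derivableP dz) => r /=.
    by rewrite bumpD.
  have dgN t : `|partial h (bump z k p t) k p| <= N.
    by apply: (dh _ _ _ _ kX).2; exact: OmegaL_bump.
  by have := lipschitz_of_derive dg dgN 0 s; rewrite bump0 sub0r normrN (distrC (entry w k p)).
have z'w k' p' : (k', p') \notin cs -> entry z' k' p' = entry w k' p'.
  rewrite entry_bump => kpcs; have [[-> ->]|kp] := (k', p') =P (k, p).
    by rewrite !eqxx mulr1 /s addrC subrK.
  have -> : (k' == k) && (p' == p) = false by rewrite -xpair_eqE; exact/eqP.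
  by rewrite mulr0 addr0 zw// inE (negbTE kpcs) orbF; exact/eqP.
apply: (le_trans (ler_distD (h z') _ _)).
rewrite big_cons mulrDr lerD//; apply: (le_trans (IH csX z' Xz' z'w)).
(* The bump leaves every other entry alone and makes entry [(k, p)] agree with [w], so no term of
   the remaining sum grows, even if [(k, p)] recurs in [cs]. *)
rewrite ler_wpM2l// ler_sum// => -[k' p'] _ /=; rewrite entry_bump.
case: eqP => [->|_] /=; last by rewrite mulr0 addr0.
case: eqP => [->|_] /=; last by rewrite mulr0 addr0.
by rewrite mulr1 /s (addrC (entry z k p)) subrK subrr normr0.
Qed.

Lemma partial_le_gradnorm (R : realType) (d : nat) (Γ : choiceType)
    (L : {fset Γ}) (h : phaseSp R d Γ -> R) (z : phaseSp R d Γ) k p :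
  k \in L -> `|partial h z k p| <= gradnorm L h z.
Proof.
move=> kL; rewrite -sqrtr_sqr /gradnorm ler_wsqrtr//.
have sq0 j i : 0 <= dP h z j i ^+ 2 + dQ h z j i ^+ 2.
  by rewrite addr_ge0 ?sqr_ge0.
rewrite (bigD1_seq k)//= ?fset_uniq// (bigD1 p.2)//= -addrA.
apply: (@le_trans _ _ (dP h z k p.2 ^+ 2 + dQ h z k p.2 ^+ 2)).
  case: p => [[] i] /=; rewrite /partial /bump /= -/(dP h z k i) -/(dQ h z k i).
    by rewrite lerDl sqr_ge0.
  by rewrite lerDr sqr_ge0.
by rewrite lerDl addr_ge0 ?sumr_ge0// => j _; exact: sumr_ge0.
Qed.

(** A [sup] dominates its elements only when the set is bounded, so most of the proof is boundedness
    over [L]: derivatives at sites outside [X] vanish, the others are at most [G]. *)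
Lemma partial_le_C1norm (R : realType) (d : nat) (Γ : choiceType)
    (X L : {fset Γ}) (h : phaseSp R d Γ -> R) :
  C1b X h -> forall z k p, OmegaL L z -> k \in L ->
  `|partial (h \o projX X) z k p| <= C1norm L (h \o projX X).
Proof.
move=> [[M hM] _ _ [G hG]] z k p Lz kL; set f := h \o projX X.
have G0 : 0 <= G.
  have := hG (projX X z) (@OmegaL_projX _ _ _ _ _); apply: le_trans; exact: sqrtr_ge0.
have fG w j q : `|partial f w j q| <= G.
  rewrite partial_projX; case: ifPn => jX; last by rewrite normr0.
  apply: (le_trans (partial_le_gradnorm _ _ _ jX)).
  exact/hG/OmegaL_projX.
have ubG : has_ubound [set gradnorm L f w | w in OmegaL L].
  exists (Num.sqrt (\sum_(j <- L) \sum_(i < d) (G ^+ 2 + G ^+ 2))) => _ [w _ <-].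
  rewrite ler_wsqrtr// ler_sum// => j _; rewrite ler_sum// => i _.
  rewrite lerD// -real_normK ?num_real// lerXn2r ?nnegrE//.
    exact: (fG w j (true, i)).
  exact: (fG w j (false, i)).
have ubM : has_ubound [set `|f w| | w in OmegaL L].
  by exists M => _ [w _ <-]; exact/hM/OmegaL_projX.
apply: (le_trans (partial_le_gradnorm f z p kL)).
rewrite /C1norm -[leLHS]add0r lerD//.
  by apply: (le_trans (normr_ge0 (f z))); apply: ub_le_sup => //; exists z.
by apply: ub_le_sup => //; exists z.
Qed.

Lemma C1b_lipschitz (R : realType) (d : nat) (Γ : choiceType)
    (X L : {fset Γ}) (h : phaseSp R d Γ -> R) :
  C1b X h -> fsubset X L -> forall z w,
  `|h (projX X z) - h (projX X w)| <=
    C1norm L (h \o projX X) * \sum_(k <- X) \sum_p `|entry z k p - entry w k p|.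
Proof.
move=> Ch XL z w.
have key u k p : OmegaL X u -> k \in X -> derivable (fun s => h (bump u k p s)) 0 1 /\
    `|partial h u k p| <= C1norm L (h \o projX X).
  move=> Xu kX; split.
    have [_ dh _ _] := Ch; have [dp dq] := dh u k p.2 Xu kX.
    by rewrite /bump; case: p.1.
  have := partial_le_C1norm (L := L) Ch p (OmegaL_sub XL Xu) (fsubsetP XL k kX).
  by rewrite partial_projX kX projX_id.
apply: (le_trans (entrywise_lipschitz key (@OmegaL_projX _ _ _ _ _) (@OmegaL_projX _ _ _ _ _))).
rewrite le_eqVlt; apply/orP; left; apply/eqP; congr (_ * _).
rewrite big_seq [RHS]big_seq; apply: eq_bigr => k kX; apply: eq_bigr => p _.
by rewrite !entry_projX kX.
Qed.

(** * Directional derivatives and Lipschitz bounds on R^d *)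

Lemma is_derive_line (R : realType) (d : nat) (G : 'rV[R]_d -> R) (x v : 'rV[R]_d) (t : R) :
  differentiable G (x + t *: v) ->
  is_derive t (1:R) (fun s => G (x + s *: v)) ('D_v G (x + t *: v)).
Proof.
move=> dG; have [dv _] := derivableP (diff_derivable (v := v) dG).
have e : (fun h : R => h^-1 *: ((G \o shift (x + t *: v)) (h *: v) - G (x + t *: v))) =
    (fun h : R => h^-1 *: (((fun s => G (x + s *: v)) \o shift t) (h *: 1) - G (x + t *: v))).
  apply/funext => h /=; congr (_ *: (G _ - _)).
  by rewrite addrCA -scalerDl; congr (_ + _ *: _); rewrite /GRing.scale /= mulr1.
by split; rewrite /derivable /derive -e.
Qed.

Lemma derive_sum_entries (R : realType) (d : nat) (G : 'rV[R]_d -> R) (x v : 'rV[R]_d) :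
  differentiable G x -> 'D_v G x = \sum_i v 0 i * 'D_(evec R i) G x.
Proof.
move=> dG; rewrite deriveE// {1}(row_sum_delta v) linear_sum /=.
by apply: eq_bigr => i _; rewrite linearZ deriveE.
Qed.

Lemma lipschitz_of_partials (R : realType) (d : nat) (G : 'rV[R]_d -> R) (B : R) :
  (forall x, differentiable G x) -> (forall x i, `|'D_(evec R i) G x| <= B) ->
  forall x y, `|G x - G y| <= B * \sum_i `|x 0 i - y 0 i|.
Proof.
move=> dG GB x y.
have dl t := is_derive_line (x := y) (v := x - y) (dG (y + t *: (x - y))).
have dlB t : `|'D_(x - y) G (y + t *: (x - y))| <= B * \sum_i `|x 0 i - y 0 i|.
  rewrite derive_sum_entries//; apply: (le_trans (ler_norm_sum _ _ _)).
  rewrite mulr_sumr ler_sum// => i _; rewrite normrM mulrC !mxE.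
  by rewrite ler_wpM2r.
have := lipschitz_of_derive dl dlB 1 0.
by rewrite scale1r scale0r addr0 [y + _]addrC subrK subr0 normr1 mulr1.
Qed.

(** * Partial derivatives of the Hamiltonian *)

Lemma is_derive_sum_seq (R : realType) (I : Type) (r : seq I) (f : I -> R -> R)
    (f' : I -> R) (t : R) :
  (forall i, is_derive t (1:R) (f i) (f' i)) ->
  is_derive t (1:R) (fun s => \sum_(i <- r) f i s) (\sum_(i <- r) f' i).
Proof.
move=> df; elim: r => [|i r IH].
  rewrite big_nil; apply: is_derive1_ext (is_derive_cst 0 t (1:R)) => s.
  by rewrite big_nil.
rewrite big_cons; apply: is_derive1_ext (is_deriveD (df i) IH) => s.
by rewrite big_cons.
Qed.

Lemma sum_indicator (R : realType) (Γ : choiceType) (L : {fset Γ}) (k : Γ) (T : Γ -> R) :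
  k \in L -> \sum_(a <- L) (a == k)%:R * T a = T k.
Proof.
move=> kL; rewrite (bigD1_seq k)//= eqxx mul1r big1 ?addr0// => a /negbTE ->.
by rewrite mul0r.
Qed.

(** The derivative is written with indicators so that the sum over sites in [Ham] collapses by
    [sum_indicator]. *)
Lemma is_derive_sqn_bump (R : realType) (d : nat) (Γ : choiceType)
    (z : phaseSp R d Γ) (k a : Γ) (p : bool * 'I_d) (b : bool) :
  is_derive (0:R) (1:R)
    (fun s => sqn (if b then (bump z k p s).1 a else (bump z k p s).2 a))
    ((a == k)%:R * ((b == p.1)%:R * (2 * entry z k p))).
Proof.
case: p => c j /=; pose D i := ((a == k) && ((b, i) == (c, j)))%:R : R.
have dsq i : is_derive (0:R) (1:R) (fun s : R => (entry z a (b, i) + s * D i) ^+ 2)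
    (2 * entry z a (b, i) * D i).
  have d1 := is_deriveD (is_derive_cst (entry z a (b, i)) (0:R) (1:R))
    (is_deriveZ (D i) (is_derive_id (0:R) (1:R))).
  have := is_deriveX 2 d1.
  rewrite !fctE /= scaler0 addr0 add0r expr1 /GRing.scale /= mulr1.
  by apply: is_derive1_ext => s; rewrite mulrC.
have := is_derive_sum_seq (index_enum 'I_d) dsq.
have -> : \sum_i 2 * entry z a (b, i) * D i =
    (a == k)%:R * ((b == c)%:R * (2 * entry z k (c, j))).
  rewrite (bigD1 j)//= big1 ?addr0 => [|i /negbTE ij].
    rewrite /D xpair_eqE eqxx andbT.
    by have [->|] := eqVneq a k; have [->|] := eqVneq b c;
      rewrite ?mulr0 ?mul0r ?mulr1 ?mul1r.
  by rewrite /D xpair_eqE ij !andbF mulr0.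
apply: is_derive1_ext => s; rewrite /sqn; apply: eq_bigr => i _.
by have := entry_bump z k (c, j) s a (b, i); rewrite -/(D i) => <-; rewrite /entry; case: (b).
Qed.

Lemma is_derive_V_bump (R : realType) (d : nat) (Γ : choiceType)
    (G : 'rV[R]_d -> R) (z : phaseSp R d Γ) (k a b : Γ) (p : bool * 'I_d) :
  (forall x, differentiable G x) ->
  is_derive (0:R) (1:R) (fun s => G ((bump z k p s).2 a - (bump z k p s).2 b))
    ((~~ p.1)%:R * ((a == k)%:R - (b == k)%:R) * 'D_(evec R p.2) G (z.2 a - z.2 b)).
Proof.
(* A bump moves the difference of positions along a line; [c] is its signed speed, one of 1, -1 and
   0, and vanishes for a momentum bump or when [a = b]. *)
move=> dG; set c := _ * (_ - _).
have := is_derive_line (x := z.2 a - z.2 b) (v := c *: evec R p.2) (t := 0) (dG _).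
rewrite scale0r addr0.
have -> : 'D_(c *: evec R p.2) G (z.2 a - z.2 b) = c * 'D_(evec R p.2) G (z.2 a - z.2 b).
  by rewrite !deriveE// linearZ.
apply: is_derive1_ext => s; congr (G _).
rewrite /c /bump; case: p.1 => /=; first by rewrite mul0r scale0r scaler0 addr0.
rewrite mul1r; case: eqP => _; case: eqP => _;
  rewrite ?subrr ?subr0 ?sub0r ?scaleNr ?scale1r ?scale0r ?scaler0 ?scalerN ?addr0//.
- by rewrite opprD addrACA subrr addr0.
- by rewrite addrAC.
- by rewrite opprD addrA.
Qed.

Lemma is_derive_Ham (R : realType) (d : nat) (Γ : choiceType) (m nu : Γ -> R)
    (V : Γ -> Γ -> 'rV[R]_d -> R) (L : {fset Γ}) (z : phaseSp R d Γ) (k : Γ)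
    (p : bool * 'I_d) :
  (forall a b x, differentiable (V a b) x) -> k \in L ->
  is_derive (0:R) (1:R) (fun s => Ham m nu V L (bump z k p s))
    ((if p.1 then (m k)^-1 else nu k) * entry z k p +
     2^-1 * \sum_(a <- L) \sum_(b <- L)
       (~~ p.1)%:R * ((a == k)%:R - (b == k)%:R) *
       'D_(evec R p.2) (V a b) (z.2 a - z.2 b)).
Proof.
move=> dV kL.
have dT a := is_deriveD
  (is_deriveZ (2 * m a)^-1 (is_derive_sqn_bump z k a p true))
  (is_deriveZ (nu a / 2) (is_derive_sqn_bump z k a p false)).
have dU := is_derive_sum_seq L (fun a => is_derive_sum_seq L
  (fun b => is_derive_V_bump z k a b p (dV a b))).
have := is_deriveD (is_derive_sum_seq L dT) (is_deriveZ 2^-1 dU).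
have -> : \sum_(a <- L) ((2 * m a)^-1 *: ((a == k)%:R * ((true == p.1)%:R * (2 * entry z k p)))
      + (nu a / 2) *: ((a == k)%:R * ((false == p.1)%:R * (2 * entry z k p)))) =
    (if p.1 then (m k)^-1 else nu k) * entry z k p.
  under eq_bigr do rewrite /GRing.scale /= !(mulrCA _ (_ == k)%:R) -mulrDr.
  (* With the inverse mass named as an atom, [field] does not ask for [m k != 0]. *)
  rewrite sum_indicator//; rewrite invfM; set mi := (m k)^-1; by case: p.1 => /=; field.
move=> dH; apply: is_derive_eq; last reflexivity.
apply: is_derive1_ext dH => s; rewrite !fctE /Ham; congr (_ + _); apply: eq_bigr => a _.
by rewrite !fctE; congr (_ + _); [exact: mulrC|exact: mulrAC].
Qed.

Lemma partial_Ham_momentum (R : realType) (d : nat) (Γ : choiceType) (m nu : Γ -> R)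
    (V : Γ -> Γ -> 'rV[R]_d -> R) (L : {fset Γ}) (z : phaseSp R d Γ) (k : Γ) i :
  (forall a b x, differentiable (V a b) x) -> k \in L ->
  partial (Ham m nu V L) z k (true, i) = (m k)^-1 * entry z k (true, i).
Proof.
move=> dV kL; have [_] := is_derive_Ham m nu z (true, i) dV kL.
rewrite /partial derive1E => ->; rewrite [X in 2^-1 * X]big1 ?mulr0 ?addr0// => a _.
by rewrite big1// => b _; rewrite /= !mul0r.
Qed.

Lemma partial_Ham_position (R : realType) (d : nat) (Γ : choiceType) (m nu : Γ -> R)
    (V : Γ -> Γ -> 'rV[R]_d -> R) (L : {fset Γ}) (z : phaseSp R d Γ) (k : Γ) i :
  (forall a b x, differentiable (V a b) x) -> k \in L ->
  partial (Ham m nu V L) z k (false, i) = nu k * entry z k (false, i) +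
    2^-1 * \sum_(a <- L) \sum_(b <- L) ((a == k)%:R - (b == k)%:R) *
      'D_(evec R i) (V a b) (z.2 a - z.2 b).
Proof.
move=> dV kL; have [_] := is_derive_Ham m nu z (false, i) dV kL.
rewrite /partial derive1E => ->; congr (_ + _ * _).
by apply: eq_bigr => a _; apply: eq_bigr => b _; rewrite mul1r.
Qed.

(** Second derivatives of [V a b] make the force Lipschitz with coupling [B * Q a b]. Against the
    profile [Q k j], the displacement of [k] itself costs the row sum [Fn], and that of the other
    sites costs the convolution constant [CF]. *)
Lemma Ham_force_bound (R : realType) (d : nat) (Γ : choiceType) (m nu : Γ -> R)
    (V : Γ -> Γ -> 'rV[R]_d -> R) (L : {fset Γ}) (Q : Γ -> Γ -> R)
    (B Fn CF Minv Nsup : R) :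
  (forall a b x, differentiable (V a b) x) ->
  (forall a b i x, differentiable (fun y => 'D_(evec R i) (V a b) y) x) ->
  (forall a b i x i',
     `|'D_(evec R i') (fun y => 'D_(evec R i) (V a b) y) x| <= B * Q a b) ->
  0 <= B -> (forall a b, 0 <= Q a b) -> (forall a b, Q a b = Q b a) ->
  (forall a, \sum_(b <- L) Q b a <= Fn) ->
  (forall a b, \sum_(c <- L) Q a c * Q c b <= CF * Q a b) ->
  (forall k, 0 < m k) -> (forall k, 0 < nu k) ->
  (forall k, (m k)^-1 <= Minv) -> (forall k, nu k <= Nsup) ->
  forall j z w (M : R), 0 <= M ->
  (forall k p, k \in L -> `|entry z k p - entry w k p| <= M * Q k j) ->
  forall k p, k \in L ->
  `|partial (Ham m nu V L) z k p - partial (Ham m nu V L) w k p| <=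
    M * (Minv + Nsup + B * d%:R * (Fn + CF)) * Q k j.
Proof.
move=> dV ddV VB B0 Q0 Qsym QFn QCF m0 nu0 mM nuN j z w M M0 zw k p kL.
have MQ0 : 0 <= M * Q k j by rewrite mulr_ge0.
have Mi0 : 0 <= Minv by apply: le_trans (mM k); rewrite invr_ge0 ltW.
have N0 : 0 <= Nsup by apply: le_trans (nuN k); exact: ltW.
have FC0 : 0 <= B * d%:R * ((Fn + CF) * Q k j).
  apply: mulr_ge0; first exact: mulr_ge0.
  rewrite mulrDl addr_ge0//.
    by rewrite mulr_ge0//; apply: le_trans (QFn k); exact: sumr_ge0.
  by apply: le_trans (QCF k j); apply: sumr_ge0 => c _; rewrite mulr_ge0.
(* One constant serves both kinds of coordinate: momentum derivatives use only the [Minv] summand,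
   position derivatives the other two. *)
have -> : M * (Minv + Nsup + B * d%:R * (Fn + CF)) * Q k j =
  Minv * (M * Q k j) + (Nsup * (M * Q k j) + M * (B * d%:R * ((Fn + CF) * Q k j))) by ring.
case: p => [[] i].
  rewrite !partial_Ham_momentum// -mulrBr normrM gtr0_norm ?invr_gt0//.
  apply: (@le_trans _ _ (Minv * (M * Q k j))).
    by apply: ler_pM => //; [rewrite invr_ge0 ltW|exact: zw].
  by rewrite lerDl addr_ge0// mulr_ge0.
rewrite !partial_Ham_position// opprD addrACA -!mulrBr -[leLHS]add0r lerD ?mulr_ge0//.
apply: (le_trans (ler_normD _ _)); apply: lerD.
  by rewrite normrM gtr0_norm//; apply: ler_pM => //; [exact: ltW|exact: zw].
pose T a b := `|'D_(evec R i) (V a b) (z.2 a - z.2 b) - 'D_(evec R i) (V a b) (w.2 a - w.2 b)|.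
have TB a b : a \in L -> b \in L -> T a b <= B * Q a b * (d%:R * (M * (Q a j + Q b j))).
  move=> aL bL; have := lipschitz_of_partials (ddV a b i) (VB a b i) (z.2 a - z.2 b) (w.2 a - w.2 b).
  move=> /le_trans; apply.
  rewrite ler_wpM2l ?mulr_ge0// [leRHS]mulr_natl -[d in leRHS]card_ord -sumr_const.
  rewrite ler_sum// => l _; rewrite !mxE mulrDr.
  have -> : z.2 a 0 l - z.2 b 0 l - (w.2 a 0 l - w.2 b 0 l) =
    (entry z a (false, l) - entry w a (false, l)) - (entry z b (false, l) - entry w b (false, l)).
    by rewrite /entry /=; ring.
  by apply: (le_trans (ler_normB _ _)); rewrite lerD// zw.
have rowB (T' : Γ -> R) : (forall b, b \in L -> T' b <= B * Q k b * (d%:R * (M * (Q k j + Q b j)))) ->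
    \sum_(b <- L) T' b <= M * (B * d%:R * ((Fn + CF) * Q k j)).
  move=> T'B; apply: (@le_trans _ _ (\sum_(b <- L) M * (B * d%:R * (Q b k * Q k j + Q k b * Q b j)))).
    rewrite big_seq [leRHS]big_seq ler_sum// => b /T'B/le_trans; apply.
    by rewrite [Q b k]Qsym le_eqVlt; apply/orP; left; apply/eqP; ring.
  rewrite -!mulr_sumr big_split/= -mulr_suml ler_wpM2l// ler_wpM2l ?mulr_ge0//.
  by rewrite mulrDl lerD// ler_wpM2r.
rewrite -sumrB normrM gtr0_norm ?invr_gt0//.
under eq_bigr do rewrite -sumrB; under eq_bigr do under eq_bigr do rewrite -mulrBr.
(* The indicators keep only row [k] and column [k]. By symmetry of [Q] both obey the same bound, and
   the prefactor 1/2 of the interaction cancels the doubling. *)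
have hT : `|\sum_(a <- L) \sum_(b <- L) ((a == k)%:R - (b == k)%:R) *
    ('D_(evec R i) (V a b) (z.2 a - z.2 b) - 'D_(evec R i) (V a b) (w.2 a - w.2 b))| <=
    \sum_(b <- L) T k b + \sum_(a <- L) T a k.
  apply: (@le_trans _ _ (\sum_(a <- L) \sum_(b <- L) ((a == k)%:R * T a b + (b == k)%:R * T a b))).
    apply: (le_trans (ler_norm_sum _ _ _)); apply: ler_sum => a _.
    apply: (le_trans (ler_norm_sum _ _ _)); apply: ler_sum => b _.
    rewrite normrM -mulrDl ler_wpM2r//.
    by apply: (le_trans (ler_normB _ _)); rewrite !normr_nat.
  under eq_bigr do rewrite big_split /= -mulr_sumr sum_indicator//.
  by rewrite big_split /= sum_indicator.
rewrite ler_pdivrMl//; apply: (le_trans hT); rewrite mulr_natl mulr2n lerD//; apply: rowB => b bL.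
  exact: TB.
by rewrite [Q k b]Qsym [Q k j + _]addrC; exact: TB.
Qed.

(** * Propagation of perturbations along the flow *)

(** Hamilton's equations exchange positions and momenta at a site; the weight [W] depends on the
    site only, so the exchange is harmless and [growth_bound] applies to all coordinate differences
    over [L]. *)
Lemma flow_growth (R : realType) (d : nat) (Γ : choiceType) (H : phaseSp R d Γ -> R)
    (L : {fset Γ}) (Phi : R -> phaseSp R d Γ -> phaseSp R d Γ) (W : Γ -> R) (K : R) :
  is_ham_flow H L Phi -> 0 < K -> (forall k, 0 < W k) ->
  (forall z w (M : R), 0 <= M ->
     (forall k p, k \in L -> `|entry z k p - entry w k p| <= M * W k) ->
     forall k p, k \in L -> `|partial H z k p - partial H w k p| <= M * (K / 2) * W k) ->
  forall z w, OmegaL L z -> OmegaL L w ->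
  (forall k p, k \in L -> `|entry z k p - entry w k p| <= W k) ->
  forall t k p, k \in L ->
  `|entry (Phi t z) k p - entry (Phi t w) k p - (entry z k p - entry w k p)| <=
    W k * (expR (K * `|t|) - 1).
Proof.
move=> flow K0 W0 dom z w Lz Lw zw t k p kL.
pose u (c : L * (bool * 'I_d)) (s : R) :=
  entry (Phi s z) (val c.1) c.2 - entry (Phi s w) (val c.1) c.2.
pose force (y : phaseSp R d Γ) (a : Γ) (q : bool * 'I_d) :=
  if q.1 then - partial H y a (false, q.2) else partial H y a (true, q.2).
pose u' (c : L * (bool * 'I_d)) (s : R) :=
  force (Phi s z) (val c.1) c.2 - force (Phi s w) (val c.1) c.2.
have dPhi y a q (s : R) : OmegaL L y -> a \in L ->
    is_derive s (1:R) (fun r => entry (Phi r y) a q) (force (Phi s y) a q).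
  move=> Ly aL; have [_ /(_ s)[_ /(_ a q.2 aL)[dp dq]]] := flow y Ly.
  by rewrite /force /entry; case: q.1.
have := @growth_bound R (L * (bool * 'I_d))%type u u' (fun c => W (val c.1)) K K0.
have Phi0 y : OmegaL L y -> Phi 0 y = y by move=> /flow[].
move=> /(_ _ _ _ _ t ([` kL]%fset, p)); rewrite /u /= !Phi0//; apply.
- by move=> c; exact: W0.
- by move=> c s; apply: is_deriveB; apply: dPhi => //; exact: valP.
- by move=> c; rewrite ?Phi0//; apply: zw; exact: valP.
- move=> s M M0 h [a q] /=.
  have hs a' q' : a' \in L -> `|entry (Phi s z) a' q' - entry (Phi s w) a' q'| <= M * W a'.
    by move=> aL; exact: (h ([` aL]%fset, q')).
  rewrite /u' /force /=; case: q.1; last by apply: dom => //; exact: valP.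
  by rewrite -opprD normrN; apply: dom => //; exact: valP.
Qed.

(** A bump of size [s] at [j] is dominated by the weight [|s| * Q k j] because [1 <= Q j j]. As [j]
    is outside [X], the initial difference vanishes on [X], and only the increment, with its factor
    [expR (K * |t|) - 1], remains. *)
Lemma partial_flow_bound (R : realType) (d : nat) (Γ : choiceType) (H : phaseSp R d Γ -> R)
    (X L : {fset Γ}) (Phi : R -> phaseSp R d Γ -> phaseSp R d Γ) (Q : Γ -> Γ -> R) (K : R)
    (h : phaseSp R d Γ -> R) (j : Γ) :
  is_ham_flow H L Phi -> 0 < K -> (forall k, 0 < Q k j) -> 1 <= Q j j ->
  (forall z w (M : R), 0 <= M ->
     (forall k p, k \in L -> `|entry z k p - entry w k p| <= M * Q k j) ->
     forall k p, k \in L -> `|partial H z k p - partial H w k p| <= M * (K / 2) * Q k j) ->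
  C1b X h -> fsubset X L -> j \in L -> j \notin X ->
  forall t z p, OmegaL L z ->
  `|partial ((h \o projX X) \o Phi t) z j p| <=
    C1norm L (h \o projX X) *
    ((2 * d)%:R * (expR (K * `|t|) - 1) * \sum_(k <- X) Q k j).
Proof.
move=> flow K0 Q0 Qjj dom Ch XL jL jX t z p Lz.
set N := C1norm _ _; set E := expR _ - 1.
have N0 : 0 <= N by apply: le_trans (normr_ge0 _) (partial_le_C1norm Ch p Lz jL).
apply: norm_derive1_le => s; rewrite bump0 /=.
(* The case [s = 0] is separate since the weights must be strictly positive. *)
have [->|s0] := eqVneq s 0; first by rewrite bump0 subrr normr0 mulr0.
apply: (le_trans (C1b_lipschitz Ch XL _ _)); rewrite -/N -!mulrA ler_wpM2l//.
have -> : (2 * d)%:R * (E * ((\sum_(k <- X) Q k j) * `|s|)) =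
    \sum_(k <- X) (2 * d)%:R * (`|s| * Q k j * E).
  by rewrite -mulr_sumr -mulr_suml -mulr_sumr; ring.
rewrite big_seq [leRHS]big_seq; apply: ler_sum => k kX.
(* The factor [2 * d] counts the scalar coordinates of one site. *)
rewrite [leRHS]mulr_natl (_ : (2 * d)%N = #|{: bool * 'I_d}|); last first.
  by rewrite card_prod card_bool card_ord.
rewrite -sumr_const; apply: ler_sum => q _.
have kL : k \in L by exact: (fsubsetP XL).
have kj : (k == j) = false by apply/eqP => kj; move: jX; rewrite -kj kX.
have := flow_growth (W := fun k => `|s| * Q k j) flow K0 _ _ (OmegaL_bump p s jL Lz) Lz _ t q kL.
rewrite entry_bump kj mulr0 addr0 subrr subr0; apply.
- by move=> a; rewrite mulr_gt0 ?normr_gt0.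
- move=> y y' M M0 hM a r aL.
  have -> : M * (K / 2) * (`|s| * Q a j) = M * `|s| * (K / 2) * Q a j by ring.
  apply: dom => //; first by rewrite mulr_ge0.
  by move=> b v bL; rewrite -mulrA; exact: hM.
- move=> a r aL; rewrite entry_bump addrC addKr normrM ler_wpM2l//.
  case: eqP => [->|_] /=; last by rewrite normr0 ltW.
  by apply: le_trans Qjj; case: (r == p); rewrite ?normr1 ?normr0.
Qed.

(** * The bracket estimate and the hyperbolic sine *)

Theorem theorem3p9 (R : realType) (d : nat)
  (CV Psi Fn CF Minv Nsup : R) :
  (0 < d)%N ->
  exists C0 : R, 0 < C0 /\
  forall (Γ : countType) (rho : Γ -> Γ -> R) (F : R -> R)
    (m nu : Γ -> R) (V : Γ -> Γ -> 'rV[R]_d -> R) (Ckl : Γ -> Γ -> R),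
  (* rho is a metric on Γ *)
  (forall x y, 0 <= rho x y) ->
  (forall x y, rho x y = 0 <-> x = y) ->
  (forall x y, rho x y = rho y x) ->
  (forall x y z, rho x z <= rho x y + rho y z) ->
  (* F : [0,oo) -> (0,oo), non-increasing, F 0 = 1 *)
  (forall r, 0 <= r -> 0 < F r) ->
  (forall r s, 0 <= r -> r <= s -> F s <= F r) ->
  F 0 = 1 ->
  (* ||F|| <= Fn (all finite partial sums bounded) *)
  (forall (y : Γ) (S : {fset Γ}), \sum_(x <- S) F (rho x y) <= Fn) ->
  (* convolution property with constant CF > 0 *)
  0 < CF ->
  (forall (x y : Γ) (S : {fset Γ}),
      \sum_(z <- S) F (rho x z) * F (rho z y) <= CF * F (rho x y)) ->
  (* masses and force constants *)
  (forall k, 0 < m k) -> (forall k, 0 < nu k) ->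
  (exists a : R, 0 < a /\ forall k, a <= (m k)^-1) ->
  (forall k, (m k)^-1 <= Minv) ->
  (exists a : R, 0 < a /\ forall k, a <= nu k) ->
  (forall k, nu k <= Nsup) ->
  (* the pair potentials *)
  (forall k l, smoothRd (V k l)) ->
  (forall k l x, V k l x = V l k (- x)) ->
  (forall k x, V k k x = 0) ->
  0 <= CV ->
  (forall k l, 0 < Ckl k l) ->
  (forall k l (beta : seq 'I_d) x,
      `|iterPD beta (V k l) x| <= Ckl k l * CV ^+ size beta) ->
  (* ||Psi|| <= Psi *)
  (forall k l, Ckl k l <= Psi * F (rho k l)) ->
  forall (X Y L : {fset Γ}) (f0 g0 : phaseSp R d Γ -> R)
    (Phi : R -> phaseSp R d Γ -> phaseSp R d Γ),
  X != fset0 -> Y != fset0 ->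
  (forall x y, x \in X -> y \in Y -> 0 < rho x y) ->
  fsubset X L -> fsubset Y L ->
  C1b X f0 -> C1b Y g0 ->
  is_ham_flow (Ham m nu V L) L Phi ->
  let f := f0 \o projX X in
  let g := g0 \o projX Y in
  forall (t : R) (z : phaseSp R d Γ), OmegaL L z ->
    `|pbracket L (f \o Phi t) g z| <=
       4 * C1norm L f * C1norm L g * Num.sqrt C0
         * sinhR (Num.sqrt C0 * `|t|) * Dxy F rho X Y /\
    `|pbracket L (f \o Phi t) g z| <=
       4 * C1norm L f * C1norm L g * Num.sqrt C0
         * (expR (Num.sqrt C0 * `|t|) - 1) * Dxy F rho X Y.
Proof.
move=> d0.
(* [K / 2] is the force constant of [Ham_force_bound] plus 1/2. Absolute values and the final 1 give
   [0 < K] although no sign of the parameters is known yet. *)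
pose K : R := 2 * (`|Minv| + `|Nsup| + `|Psi| * CV ^+ 2 * d%:R * (`|Fn| + `|CF|)) + 1.
(* [r] will be the square root of [C0]; the summand [2 * d ^ 2] absorbs the dimensional prefactor of
   the bracket estimate. *)
pose r : R := K + (2 * d ^ 2)%:R.
have K0 : 0 < K.
  apply: ltr_wpDl => //; apply: mulr_ge0 => //; apply: addr_ge0; first exact: addr_ge0.
  apply: mulr_ge0; last exact: addr_ge0.
  by apply: mulr_ge0 => //; apply: mulr_ge0 => //; exact: sqr_ge0.
have Kr : K <= r by rewrite lerDl.
have r0 : 0 < r by exact: lt_le_trans Kr.
exists (r ^+ 2); split; first by rewrite exprn_gt0.
move=> Γ rho F m nu V Ckl rho0 rhoE rhoC _ F0 _ F00 FFn CF0 FCF m0 nu0 _ mM _ nuN.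
move=> Vs _ _ CV0 Ckl0 VC CPsi X Y L f0 g0 Phi _ Yn XYpos XL YL Cf Cg flow f g t z Lz.
rewrite sqrtr_sqr (gtr0_norm r0).
pose Q a b := F (rho a b).
have Q0 a b : 0 < Q a b by exact: F0.
have dV a b x : differentiable (V a b) x by exact: (Vs a b [::]).
have ddV a b i x : differentiable (fun y => 'D_(evec R i) (V a b) y) x.
  exact: (Vs a b [:: i]).
have [y0 y0Y] : exists y, y \in Y by exact/fset0Pn.
have Psi0 : 0 < Psi.
  by rewrite -(pmulr_lgt0 _ (Q0 y0 y0)); exact: lt_le_trans (Ckl0 _ _) (CPsi _ _).
have VB a b i x i' : `|'D_(evec R i') (fun y => 'D_(evec R i) (V a b) y) x| <=
    Psi * CV ^+ 2 * Q a b.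
  apply: (le_trans (VC a b [:: i'; i] x)).
  by rewrite mulrAC ler_wpM2r ?exprn_ge0// CPsi.
have Qsym a b : Q a b = Q b a by rewrite /Q rhoC.
have dom j u w (M : R) : 0 <= M ->
    (forall k p, k \in L -> `|entry u k p - entry w k p| <= M * Q k j) ->
    forall k p, k \in L ->
    `|partial (Ham m nu V L) u k p - partial (Ham m nu V L) w k p| <= M * (K / 2) * Q k j.
  move=> M0 uw k p kL.
  have Q0' a b : 0 <= Q a b by exact: ltW.
  have B0 : 0 <= Psi * CV ^+ 2 by rewrite mulr_ge0 ?exprn_ge0// ltW.
  apply: (le_trans (Ham_force_bound dV ddV VB B0 Q0' Qsym (fun a => FFn a L)
    (fun a b => FCF a b L) m0 nu0 mM nuN M0 uw p kL)).
  have -> : K / 2 = `|Minv| + `|Nsup| + `|Psi| * CV ^+ 2 * d%:R * (`|Fn| + `|CF|) + 2^-1.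
    by rewrite /K; field.
  rewrite ler_wpM2r// ler_wpM2l//.
  rewrite (gtr0_norm Psi0) -[leLHS]addr0; apply: lerD; last by rewrite invr_ge0.
  apply: lerD; first by apply: lerD; exact: ler_norm.
  apply: ler_wpM2l; first exact: mulr_ge0.
  by apply: lerD; exact: ler_norm.
set Nf := C1norm L f; set Ng := C1norm L g.
set E := expR (K * `|t|) - 1.
have E0 : 0 <= E by rewrite subr_ge0 -expR0 ler_expR mulr_ge0// ltW.
have y0L := fsubsetP YL _ y0Y.
have Nf0 : 0 <= Nf by apply: le_trans (normr_ge0 _) (partial_le_C1norm Cf (true, Ordinal d0) Lz y0L).
have Ng0 : 0 <= Ng by apply: le_trans (normr_ge0 _) (partial_le_C1norm Cg (true, Ordinal d0) Lz y0L).
have D0 : 0 <= Dxy F rho X Y by apply: sumr_ge0 => x _; apply: sumr_ge0 => y _; exact/ltW/F0.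
(* The factor [4 * d ^ 2] arises from [d] directions, two products per direction and [2 * d]
   coordinates at each site of [X]. *)
have main : `|pbracket L (f \o Phi t) g z| <= 4 * Nf * Ng * ((d ^ 2)%:R * E) * Dxy F rho X Y.
  pose A p j := `|partial (f \o Phi t) z j p|.
  pose G p j := `|partial g z j p|.
  pose T j := \sum_(i < d) (A (false, i) j * G (true, i) j + A (true, i) j * G (false, i) j).
  apply: (@le_trans _ _ (\sum_(j <- L) T j)).
    apply: (le_trans (ler_norm_sum _ _ _)); apply: ler_sum => j _.
    apply: (le_trans (ler_norm_sum _ _ _)); apply: ler_sum => i _.
    by apply: (le_trans (ler_normB _ _)); rewrite !normrM.
  (* Only sites of [Y] contribute, since [g] ignores the other entries; positive distance then puts
     them outside [X]. *)
  rewrite -(big_fset_incl _ YL) => [|j jL jY]; last first.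
    rewrite /T big1// => i _.
    by rewrite /G !partial_projX (negbTE jY) normr0 !mulr0 addr0.
  rewrite /Dxy [in leRHS]exchange_big mulr_sumr big_seq [leRHS]big_seq; apply: ler_sum => j jY.
  have jL := fsubsetP YL _ jY.
  have jX : j \notin X.
    by apply/negP => jX; have := XYpos _ _ jX jY; rewrite ((rhoE j j).2 erefl) ltxx.
  have Qjj : 1 <= Q j j by rewrite /Q ((rhoE j j).2 erefl) F00.
  have AB p : A p j <= Nf * ((2 * d)%:R * E * \sum_(x <- X) Q x j).
    exact: (partial_flow_bound flow K0 (fun k => Q0 k j) Qjj (dom j) Cf XL jL jX t p Lz).
  have GB p : G p j <= Ng by exact: (partial_le_C1norm Cg p Lz jL).
  apply: (@le_trans _ _ (\sum_(i < d)
     ((Nf * ((2 * d)%:R * E * \sum_(x <- X) Q x j)) * Ng *+ 2))).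
    by apply: ler_sum => i _; rewrite mulr2n; apply: lerD; apply: ler_pM => //; exact: normr_ge0.
  rewrite sumr_const card_ord -mulrnA -[leLHS]mulr_natr !natrM.
  by rewrite le_eqVlt; apply/orP; left; apply/eqP; ring.
have x0 : 0 <= r * `|t| by rewrite mulr_ge0// ltW.
have ex1 : 1 <= expR (r * `|t|) by rewrite -expR0 ler_expR.
have emx1 : expR (- (r * `|t|)) <= 1 by rewrite -expR0 ler_expR oppr_le0.
(* With [a] and [b] the two exponentials, [a * b = 1], and the claim amounts to [2 <= a + b]. *)
have sinh_exp : sinhR (r * `|t|) <= expR (r * `|t|) - 1.
  rewrite /sinhR ler_pdivrMr//.
  have h : expR (r * `|t|) * expR (- (r * `|t|)) = 1 by rewrite -expRD subrr expR0.
  set a := expR (r * `|t|) in h ex1 *; set b := expR (- _) in h emx1 *.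
  nra.
(* Since [K <= r] and [expR (- (r * |t|)) <= 1], [E] is at most twice the hyperbolic sine; then
   [2 * d ^ 2 <= r] absorbs the prefactor. *)
have Esinh : (d ^ 2)%:R * E <= r * sinhR (r * `|t|).
  have h : E <= 2 * sinhR (r * `|t|).
    rewrite /sinhR mulrCA divff// mulr1 lerB//.
    by rewrite ler_expR ler_wpM2r.
  apply: (@le_trans _ _ ((d ^ 2)%:R * (2 * sinhR (r * `|t|)))); first by rewrite ler_wpM2l.
  have s0 : 0 <= sinhR (r * `|t|) by rewrite -(pmulr_rge0 _ (ltr0Sn R 1)); exact: le_trans h.
  by rewrite mulrA ler_wpM2r// -natrM mulnC lerDr ltW.
have NN : 0 <= 4 * Nf * Ng by rewrite !mulr_ge0.
have res : `|pbracket L (f \o Phi t) g z| <= 4 * Nf * Ng * r * sinhR (r * `|t|) * Dxy F rho X Y.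
  by apply: (le_trans main); apply: ler_wpM2r => //; rewrite -[leRHS]mulrA; apply: ler_wpM2l.
split => //; apply: (le_trans res).
by rewrite ler_wpM2r// ler_wpM2l// mulr_ge0// ltW.
Qed.
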